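(* Let $h\in\mathbb{C}[x,y,z]$ be an irreducible homogeneous polynomial of degree $r$ such that $x,y$ are homogeneous parameters, i.e. $h=cz^r+$ other terms with $c\neq 0$. Let $X=\{h=0\}\subset\mathbb{C}^3$ and suppose that $X$ is normal (hence the projective curve $Y=\{h=0\}\subset\mathbb{P}^2$ is smooth). Let $P=0\in X$ be the vertex. Let $d_1,d_2\geq 1$ and $d_0$ be integers such that $d_1+d_2<d_0<r$. Then the functions $f_1=x^{d_1}$, $f_2=y^{d_2}$, $f_0=z^{d_0}$ on $X$, which are homogeneous of degrees $d_1,d_2,d_0$, satisfy: (1) the common zero set of $f_1$ and $f_2$ in $X$ is exactly $\{P\}$; (2) $f_0\notin(f_1,f_2)\,\mathcal{O}_{X,P}$; (3) $d_1+d_2-d_0<0$.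
   Context: $\mathcal{O}_{X,P}$ is the local ring of germs of holomorphic functions on the complex analytic space $X$ at $P$. *)

(* Defs.v *)
From mathcomp Require Import all_boot all_order all_algebra.
From mathcomp Require Import complex.
From mathcomp Require Import all_classical all_reals all_analysis.
From mathcomp Require Import summability.
(* The notations of mpoly clash with those of the analysis library. *)
From mathcomp Require Import -(notations) mpoly.

Set Implicit Arguments.
Unset Strict Implicit.
Unset Printing Implicit Defensive.

Import Order.TTheory GRing.Theory Num.Theory.
Import numFieldNormedType.Exports.

Local Open Scope classical_set_scope.
Local Open Scope ring_scope.

Notation "{ 'mpoly' T [ n ] }" := (mpoly n T) : type_scope.

Definition irreducible_elt (D : idomainType) (x : D) : Prop :=
  [/\ x != 0, x \isn't a GRing.unit &
      forall a b : D, x = a * b -> a \is a GRing.unit \/ b \is a GRing.unit].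

Section AnalyticGerms.
Context {R : realType} {n : nat}.

Local Notation C := R[i].
(* C^o is C as a normed space over itself; it provides the topology of C^n. *)
Local Notation pt := 'rV[C^o]_n.

Definition poly_fun (f : {mpoly C[n]}) (v : pt) : C := meval (v ord0) f.

Definition zero_locus (f : {mpoly C[n]}) : set pt :=
  [set v | poly_fun f v = 0].

(* The multiple series sum_m a_m w^m, over all exponents m in N^n, has sum l:
   its finite partial sums converge to l along the directed set of finite sets
   of exponents.  This unordered convergence is absolute convergence. *)
Definition power_series_sum (a : multinom n -> C) (w : pt) (l : C) : Prop :=
  partial_sum (fun m : multinom n => a m * mmap1 (w ord0) m : C^o) @ totally
    --> (l : C^o).

Definition holomorphic_at (p : pt) (F : pt -> C) : Prop :=
  exists a : multinom n -> C,
    \forall v \near p, power_series_sum a (v - p) (F v).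

(* The local ring O_{X,p} of germs at p of holomorphic functions on the reduced
   analytic space X in C^n is handled through representatives: its elements are
   represented by the functions f with [holo_germ X p f], i.e. those which
   coincide on X near p with a function holomorphic near p in C^n, and f, g
   represent the same germ iff [eq_germ X p f g].  Values outside X are
   irrelevant. *)
Definition eq_germ (X : set pt) (p : pt) (f g : pt -> C) : Prop :=
  \forall v \near p, X v -> f v = g v.

Definition holo_germ (X : set pt) (p : pt) (f : pt -> C) : Prop :=
  exists2 F : pt -> C, holomorphic_at p F & eq_germ X p f F.

(* f \in (f1, f2) O_{X,p} *)
Definition in_germ_ideal2 (X : set pt) (p : pt) (f1 f2 f : pt -> C) : Prop :=
  exists a b : pt -> C,
    [/\ holo_germ X p a, holo_germ X p b &
        eq_germ X p f (fun v => a v * f1 v + b v * f2 v)].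

Definition germ_domain (X : set pt) (p : pt) : Prop :=
  forall f g : pt -> C, holo_germ X p f -> holo_germ X p g ->
    eq_germ X p (fun v => f v * g v) (fun=> 0) ->
    eq_germ X p f (fun=> 0) \/ eq_germ X p g (fun=> 0).

(* If the fraction f / g is a root of the monic polynomial
   T^k + \sum_(i < k) c_i T^i with coefficients in O_{X,p} (an equation written
   below after multiplication by g^k), then f / g lies in O_{X,p}. *)
Definition germ_integrally_closed (X : set pt) (p : pt) : Prop :=
  forall f g : pt -> C, holo_germ X p f -> holo_germ X p g ->
    ~ eq_germ X p g (fun=> 0) ->
  forall (k : nat) (c : 'I_k -> pt -> C), (forall i, holo_germ X p (c i)) ->
    eq_germ X p
      (fun v => f v ^+ k + \sum_(i < k) c i v * f v ^+ i * g v ^+ (k - i))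
      (fun=> 0) ->
  exists2 q : pt -> C, holo_germ X p q & eq_germ X p f (fun v => q v * g v).

(* Every local ring of X is an integrally closed domain. *)
Definition normal_analytic_set (X : set pt) : Prop :=
  forall p : pt, X p -> germ_domain X p /\ germ_integrally_closed X p.

End AnalyticGerms.

(* Main.v *)
Require Import Defs.
From HB Require Import structures.
From mathcomp Require Import all_boot all_order all_algebra.
From mathcomp Require Import complex zify ring finmap.
From mathcomp Require Import all_classical all_reals all_analysis.
From mathcomp Require Import summability.
From mathcomp Require Import -(notations) mpoly.

(* Suppose z^d0 = a x^d1 + b y^d2 on X near 0.  As X is a cone, comparing the
   terms of degree d0 along each line of X through 0 replaces a and b by forms:
   some form g = z^d0 - g1 x^d1 - g2 y^d2 of degree d0 < r vanishes on X.
   Put y = 1.  In C[x][z] the dehomogenizations of h and g cannot be coprime over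
   C(x): otherwise their resultant is a nonzero polynomial of x, and for a value
   of x which is not one of its roots h would have a zero outside {g = 0}.  Their
   gcd is then a factor of h over C(x), proper since d0 < r, which Gauss's lemma
   and homogenization turn into a factor of h, against its irreducibility. *)

Set Implicit Arguments.
Unset Strict Implicit.
Unset Printing Implicit Defensive.

Import Order.TTheory GRing.Theory Num.Theory.
Import numFieldNormedType.Exports.

Local Open Scope classical_set_scope.
Local Open Scope ring_scope.

(** * Dehomogenization at y = 1 *)

Section Dehomogenization.
Variable F : fieldType.
Implicit Types (p : {mpoly F[3]}) (P Q : {poly {poly F}}).

Definition mvar (i : 'I_3) : {mpoly F[3]} := mpolyX F (mnm1 i).

(** [{poly {poly F}}] is F[x][z]: x is the inner variable and z the outer one, so that resultants of
    dehomogenizations eliminate z. *)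
Definition dehom_val (i : 'I_3) : {poly {poly F}} :=
  if i == 0 then 'X%:P else if i == 1 then 1 else 'X.

Definition dehom : {mpoly F[3]} -> {poly {poly F}} :=
  mmap (polyC \o polyC) dehom_val.

HB.instance Definition _ := GRing.RMorphism.on dehom.

Definition mnm3 (i j k : nat) : multinom 3 := Multinom [tuple i; j; k].

Lemma mdeg3 (m : multinom 3) : mdeg m = (m 0%R + m 1%R + m 2%R)%N.
Proof.
rewrite mdegE !big_ord_recl big_ord0 addn0 addnA.
by congr (m _ + m _ + m _)%N; apply/val_inj.
Qed.

Lemma mnm3P (m : multinom 3) i j k :
  (m == mnm3 i j k) = [&& m 0 == i, m 1 == j & m 2 == k].
Proof.
apply/eqP/and3P => [->|[/eqP e0 /eqP e1 /eqP e2]]; first by [].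
apply/mnmP => -[[|[|[|?]]] lt3] //.
- by rewrite -[RHS]e0; congr (m _); apply/val_inj.
- by rewrite -[RHS]e1; congr (m _); apply/val_inj.
- by rewrite -[RHS]e2; congr (m _); apply/val_inj.
Qed.

Lemma dehomX (m : multinom 3) :
  dehom (mpolyX F m) = ('X ^+ m 0)%:P * 'X ^+ m 2.
Proof.
rewrite /dehom mmapX /mmap1 !big_ord_recl big_ord0 /dehom_val /=.
rewrite expr1n mul1r mulr1 polyC_exp.
by congr (_ ^+ m _ * _ ^+ m _); apply/val_inj.
Qed.

Lemma coef_dehom p i j : (dehom p)`_j`_i =
  \sum_(m <- msupp p) mcoeff m p * ((m 0 == i) && (m 2 == j))%:R.
Proof.
rewrite {1}[p]mpolyE raddf_sum coef_sum coef_sum.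
apply: eq_bigr => m _.
have E : dehom (mcoeff m p *: mpolyX F m) =
    ((mcoeff m p)%:P * 'X ^+ m 0)%:P * 'X ^+ m 2.
  by rewrite -mul_mpolyC rmorphM /= dehomX [dehom _]mmapC /= polyCM mulrA.
transitivity ((((mcoeff m p)%:P * 'X ^+ m 0)%:P * 'X ^+ m 2)`_j`_i).
  by rewrite -E.
rewrite coefCM coefXn (eq_sym (m 0)) (eq_sym (m 2)).
by case: (j == _); rewrite ?andbT ?andbF ?mulr1 ?mulr0 ?coef0 // coefCM coefXn.
Qed.

(** In a monomial of a form of degree d the exponents of x and z determine that of y, so distinct
    monomials stay distinct at y = 1. *)
Lemma coef_dehom_homog d p i j : p \is ishomog1 d mdeg ->
  (dehom p)`_j`_i =
    if (i + j <= d)%N then mcoeff (mnm3 i (d - (i + j)) j) p else 0.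
Proof.
move=> /dhomogP hp; rewrite coef_dehom.
have eqm m : m \in msupp p ->
    (m 0 == i) && (m 2 == j) = (i + j <= d)%N && (m == mnm3 i (d - (i + j)) j).
  move=> /hp /= md; have {md} : mdeg m = d := md.
  rewrite mdeg3 mnm3P => <-.
  apply/andP/and4P => [[/eqP-> /eqP->]|[_ -> _ ->]] //.
  by rewrite !eqxx addnAC leq_addr addnC addnK eqxx.
rewrite (eq_big_seq (fun m : multinom 3 => if (i + j <= d)%N then
    mcoeff m p * (m == mnm3 i (d - (i + j)) j)%:R else 0)); last first.
  by move=> m /eqm ->; case: ifP => //; rewrite mulr0.
case: ifP => _; last by rewrite big1.
set m0 := mnm3 _ _ _.
have [m0p|m0p] := boolP (m0 \in msupp p).
  rewrite (bigD1_seq m0) //= ?msupp_uniq // eqxx mulr1 big1 ?addr0 // => m ne.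
  by rewrite (negbTE ne) mulr0.
rewrite big1_seq => [|m /andP[_ mp]]; last first.
  by case: eqP mp => [->|]; rewrite ?(negbTE m0p) ?mulr0.
by move: m0p; rewrite -mcoeff_eq0 => /eqP.
Qed.

Lemma size_dehom d p : p \is ishomog1 d mdeg -> (size (dehom p) <= d.+1)%N.
Proof.
move=> hp; apply/leq_sizeP => j lt_dj; apply/polyP => i.
rewrite (coef_dehom_homog _ _ hp) coef0 leqNgt.
by rewrite (leq_trans lt_dj) ?leq_addl.
Qed.

(** Homogeneity leaves no room for x next to z^d. When this constant is nonzero, it fixes the degree
    in z and survives every specialization of x. *)
Lemma coef_dehom_top d p : p \is ishomog1 d mdeg ->
  (dehom p)`_d = (mcoeff (mnm_muln (mnm1 (2 : 'I_3)) d) p)%:P.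
Proof.
move=> hp; apply/polyP => i; rewrite (coef_dehom_homog _ _ hp) coefC.
case: i => [|i]; last by rewrite ifF // leqNgt ltnS leq_addl.
rewrite add0n leqnn subnn /=; congr (mcoeff _ p); apply/esym/eqP.
by rewrite mnm3P !mulmnE !mnm1E eqxx mul1n eqxx.
Qed.

Lemma dehom_homog_inj d p : p \is ishomog1 d mdeg -> dehom p = 0 -> p = 0.
Proof.
move=> hp p0; apply/mpolyP => m; rewrite mcoeff0.
have [mp|] := boolP (m \in msupp p); last by rewrite -mcoeff_eq0 => /eqP.
have md : mdeg m = d := dhomog_mf hp mp.
have := coef_dehom_homog (m 0) (m 2) hp; rewrite p0 !coef0.
rewrite -md mdeg3 addnAC leq_addr addnC addnK => ->.
by congr (mcoeff _ p); apply/eqP; rewrite mnm3P !eqxx.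
Qed.

(** A section of [dehom] with values free of y; through it [msize] measures the total degree in x
    and z of an element of F[x][z]. *)
Definition poly2_mpoly : {poly {poly F}} -> {mpoly F[3]} :=
  horner_eval (mvar 2) \o
    map_poly (horner_eval (mvar 0) \o map_poly (@mpolyC 3 F)).

HB.instance Definition _ := GRing.RMorphism.on poly2_mpoly.

Lemma poly2_mpolyCC c : poly2_mpoly c%:P%:P = @mpolyC 3 F c.
Proof.
by rewrite /poly2_mpoly /= map_polyC /= map_polyC /= /horner_eval !hornerC.
Qed.

Lemma poly2_mpolyCX : poly2_mpoly 'X%:P = mvar 0.
Proof.
rewrite /poly2_mpoly /= map_polyC /= map_polyX /= /horner_eval.
by rewrite hornerC hornerX.
Qed.

Lemma poly2_mpolyX : poly2_mpoly 'X = mvar 2.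
Proof. by rewrite /poly2_mpoly /= map_polyX /= /horner_eval hornerX. Qed.

Lemma poly2_mpolyK P : dehom (poly2_mpoly P) = P.
Proof.
have dv i : dehom (mvar i) = dehom_val i.
  by rewrite /dehom mmapX mmap1U.
elim/poly_ind: P => [|P c IH]; first by rewrite !rmorph0.
rewrite !rmorphD !rmorphM /= poly2_mpolyX dv IH; congr (_ * _ + _).
elim/poly_ind: c => [|c a IHc]; first by rewrite !rmorph0.
rewrite polyCD polyCM !rmorphD !rmorphM /= IHc poly2_mpolyCX dv.
by rewrite poly2_mpolyCC [X in _ + X]mmapC.
Qed.

Lemma msize_dehom d p : p \is ishomog1 d mdeg ->
  (msize (poly2_mpoly (dehom p)) <= d.+1)%N.
Proof.
move=> /dhomogP hp; rewrite [p]mpolyE.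
rewrite (raddf_sum dehom) (raddf_sum poly2_mpoly) /=.
apply: (leq_trans (msize_sum _ _ _)); apply/bigmax_leqP_seq => m mp _ /=.
have -> : poly2_mpoly (dehom (mcoeff m p *: mpolyX F m)) =
    mcoeff m p *: mpolyX F (mnm3 (m 0) 0 (m 2)).
  rewrite -mul_mpolyC !rmorphM /= dehomX [dehom _]mmapC /= poly2_mpolyCC.
  rewrite mul_mpolyC polyC_exp rmorphM !rmorphXn /=.
  rewrite poly2_mpolyCX poly2_mpolyX !mpolyXn -mpolyXD; congr (_ *: mpolyX _ _).
  apply/eqP; rewrite mnm3P !mnmDE !mulmnE !mnm1E /=.
  by rewrite !mul0n !mul1n addn0 !eqxx.
apply: (leq_trans (msizeZ_le _ _)); rewrite msizeX ltnS mdeg3.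
have <- : mdeg m = d := hp m mp.
by rewrite mdeg3 addn0 leq_add2r leq_addr.
Qed.

Lemma homogenize N p : (msize p <= N.+1)%N ->
  exists2 q, q \is ishomog1 N mdeg & dehom q = dehom p.
Proof.
(* The component of degree k is padded with y^(N - k), which [dehom] sends to 1. *)
move=> leN; exists (\sum_(k < N.+1) pihomog mdeg k p * mvar 1 ^+ (N - k)).
  apply: rpred_sum => k _.
  have y1 : mvar 1 \is ishomog1 1 mdeg by rewrite dhomogX; apply/eqP/mdeg1.
  have := dhomogM (pihomogP mdeg k p) (dhomogMn (N - k) y1).
  by rewrite mul1n subnKC // -ltnS.
rewrite [in RHS](pihomog_partitionE (leN : (mmeasure mdeg p <= _)%N)).
rewrite !(raddf_sum dehom).
apply: eq_bigr => k _ /=; rewrite (rmorphM dehom) (rmorphXn dehom).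
have y1 : dehom (mvar 1) = 1 by rewrite /dehom mmapX mmap1U.
by rewrite [X in _ * X ^+ _]y1 expr1n mulr1.
Qed.

(** The factors P and Q homogenize to forms whose product has degree d and the dehomogenization of
    [p], hence is [p]. One of these forms is then a unit, that is, a constant. *)
Lemma dehom_irreducible d p P Q : irreducible_elt p -> p \is ishomog1 d mdeg ->
  dehom p = P * Q -> (size P <= 1)%N \/ (size Q <= 1)%N.
Proof.
case=> p0 _ irr hp pE.
have sPQ := msize_dehom hp.
have nz : poly2_mpoly (dehom p) != 0.
  apply: contra_neq p0 => e; apply: (dehom_homog_inj hp).
  by rewrite -[dehom p]poly2_mpolyK e rmorph0.
move: nz sPQ; rewrite pE rmorphM /= mulf_eq0 negb_or => /andP[nP nQ].
rewrite msizeM // (mpolySpred _ nP) (mpolySpred _ nQ) addnS addSn /= !ltnS.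
set N := (_.-1); set M := (_.-1) => leNM.
have [|P' hP' P'E] := @homogenize N (poly2_mpoly P).
  by rewrite /N -mpolySpred.
(* The total degree M of Q may be less than d - N; powers of y fill the gap, so that the degrees add
   up to d. *)
have [|Q' hQ' Q'E] := @homogenize (d - N) (poly2_mpoly Q).
  rewrite (mpolySpred _ nQ) ltnS -/M leq_subRL //.
  by rewrite (leq_trans _ leNM) ?leq_addr.
have {}P'E : dehom P' = P by rewrite P'E poly2_mpolyK.
have {}Q'E : dehom Q' = Q by rewrite Q'E poly2_mpolyK.
have sunit q : q \is a GRing.unit -> (size (dehom q) <= 1)%N.
  by case/andP=> /eqP-> _; rewrite [dehom _]mmapC size_polyC; case: (_ == _).
have eq_p : p = P' * Q'.
  apply/eqP; rewrite -subr_eq0; apply/eqP; apply: (@dehom_homog_inj d).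
    rewrite rpredB // -(@subnKC N d) ?dhomogM //.
    by rewrite (leq_trans _ leNM) ?leq_addr.
  by rewrite rmorphB rmorphM /= P'E Q'E pE subrr.
by case: (irr _ _ eq_p) => /sunit; rewrite ?P'E ?Q'E; [left|right].
Qed.

End Dehomogenization.

(* A linear factor X - a of c divides q or s, since evaluation at a maps q * s
   to 0 in the domain F[Z]; cancel the factors of c one by one. *)
Lemma gauss_poly_closed (F : closedFieldType) (c : {poly F})
    (p q s : {poly {poly F}}) : c != 0 -> c *: p = q * s ->
  exists q' s', [/\ p = q' * s', size q' = size q & size s' = size s].
Proof.
have [n] := ubnP (size c); elim: n => // n IHn in c q s *.
rewrite ltnS => szc c0 pqs.
have [c1|c1] := eqVneq (size c) 1.
  have /size_poly1P[a a0 cE] : size c == 1 by rewrite c1.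
  exists (a^-1%:P *: q), s; split=> //; last first.
    by rewrite size_scale // polyC_eq0 invr_eq0.
  by rewrite -scalerAl -pqs scalerA cE -polyCM mulVf // scale1r.
have [a ra] := closed_rootP c c1.
have /factor_theorem[c' cE] := ra.
pose ev := map_poly (horner_eval a) : {poly {poly F}} -> {poly F}.
have ev0 t : ev t = 0 -> exists t', t = ('X - a%:P) *: t'.
  move=> et; exists (map_poly (fun u => u %/ ('X - a%:P)) t).
  apply/polyP => i; rewrite coefZ coef_map_id0 ?div0p // mulrC divpK //.
  rewrite dvdp_XsubCl; apply/eqP.
  have := congr1 (fun u : {poly F} => u`_i) et.
  by rewrite coef_map coef0.
have c'0 : c' != 0 by apply: contra_neq c0 => c'0; rewrite cE c'0 mul0r.
have szc' : (size c' < n)%N.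
  move: szc; rewrite cE size_Mmonic ?monicXsubC // size_XsubC addn2 /=.
  by [].
have Xa0 : 'X - a%:P != 0 :> {poly F} by rewrite polyXsubC_eq0.
have : ev q * ev s = 0.
  rewrite -rmorphM -pqs cE; apply/polyP => i.
  by rewrite coef_map coefZ coef0 /= /horner_eval !hornerE subrr mulr0 mul0r.
have cancelX (t u : {poly {poly F}}) :
    ('X - a%:P) *: t = ('X - a%:P) *: u -> t = u.
  by rewrite -!mul_polyC => /mulfI; apply; rewrite polyC_eq0.
move/eqP; rewrite mulf_eq0 => /orP[]/eqP/ev0[t tE].
  have [|q' [s' [e1 e2 e3]]] := IHn c' t s szc' c'0.
    by apply: cancelX; rewrite scalerA mulrC -cE pqs tE scalerAl.
  by exists q', s'; split; rewrite // tE size_scale.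
have [|q' [s' [e1 e2 e3]]] := IHn c' q t szc' c'0.
  by apply: cancelX; rewrite scalerA mulrC -cE pqs tE scalerAr.
by exists q', s'; split; rewrite // tE size_scale.
Qed.

(** Serves twice: [h] vanishes on the z-axis only at 0, and the coefficient of z^d0 in a form of
    degree d0 is its value at (0, 0, 1). *)
Lemma meval_axis (F : fieldType) (p : {mpoly F[3]}) d (v : 'I_3 -> F) :
  p \is ishomog1 d mdeg -> v 0 = 0 -> v 1 = 0 ->
  meval v p = mcoeff (mnm_muln (mnm1 (2 : 'I_3)) d) p * v 2 ^+ d.
Proof.
move=> /dhomogP hp v0 v1.
rewrite [p in mcoeff _ p]mpolyE raddf_sum mulr_suml mevalE.
apply: eq_big_seq => m mp /=; rewrite mcoeffZ mcoeffX -mulrA; congr (_ * _).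
have md : mdeg m = d := hp m mp.
have -> : \prod_i v i ^+ m i = v 0 ^+ m 0 * v 1 ^+ m 1 * v 2 ^+ m 2.
  rewrite !big_ord_recl big_ord0 mulr1 mulrA.
  by congr (v _ ^+ m _ * v _ ^+ m _ * v _ ^+ m _); apply/val_inj.
have -> : mnm_muln (mnm1 (2 : 'I_3)) d = mnm3 0 0 d.
  by apply/eqP; rewrite mnm3P !mulmnE !mnm1E eqxx mul1n eqxx.
rewrite mnm3P v0 v1 !expr0n -md mdeg3.
by case: (m 0) => [|?]; case: (m 1) => [|?];
  rewrite /= ?eqxx ?(mul0r, mulr0, mul1r).
Qed.

(** * Forms vanishing on the cone *)

Definition affine_point (C : fieldType) (a b : C) (i : 'I_3) : C :=
  if i == 0 then a else if i == 1 then 1 else b.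

Lemma horner_dehom (C : fieldType) (p : {mpoly C[3]}) a b :
  (dehom p).[b%:P].[a] = meval (affine_point a b) p.
Proof.
rewrite -[LHS]/(horner_eval a (horner_eval b%:P (dehom p))).
rewrite [p in LHS]mpolyE (raddf_sum (@dehom C)) !raddf_sum mevalE.
apply: eq_bigr => m _.
transitivity ((((mcoeff m p)%:P%:P * (('X ^+ m 0)%:P * 'X ^+ m 2))).[b%:P].[a]).
  suff <- : dehom (mcoeff m p *: mpolyX C m) =
      (mcoeff m p)%:P%:P * (('X ^+ m 0)%:P * 'X ^+ m 2) by [].
  by rewrite -mul_mpolyC rmorphM /= dehomX [dehom _]mmapC.
rewrite !(hornerM, hornerXn, hornerC, horner_exp).
rewrite !big_ord_recl big_ord0 /affine_point /= expr1n mulr1 mul1r.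
by congr (_ * (_ ^+ m _ * _ ^+ m _)); apply/val_inj.
Qed.

Lemma vanishing_form_degree (C : closedFieldType) (h g : {mpoly C[3]})
    (r d : nat) :
  irreducible_elt h -> h \is ishomog1 r mdeg ->
  mcoeff (mnm_muln (mnm1 (2 : 'I_3)) r) h != 0 ->
  (0 < d)%N -> g \is ishomog1 d mdeg ->
  mcoeff (mnm_muln (mnm1 (2 : 'I_3)) d) g != 0 ->
  (forall v, meval v h = 0 -> meval v g = 0) -> (r <= d)%N.
Proof.
move=> h_irr hh h_top d_gt0 hg g_top van; rewrite leqNgt; apply/negP => lt_dr.
have size_top e p : p \is ishomog1 e mdeg ->
    mcoeff (mnm_muln (mnm1 (2 : 'I_3)) e) p != 0 -> size (@dehom C p) = e.+1.
  move=> hp top; apply/eqP; rewrite eqn_leq size_dehom //=.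
  rewrite ltnNge; apply/negP => /leq_sizeP/(_ e (leqnn e)).
  by move/eqP; rewrite (coef_dehom_top hp) polyC_eq0 (negbTE top).
have szh := size_top _ _ hh h_top; have szg := size_top _ _ hg g_top.
have g0 : dehom g != 0 by rewrite -size_poly_gt0 szg.
have gcd_small : (size (gcdp (dehom h) (dehom g)) <= 1)%N.
  rewrite leqNgt; apply/negP => gcd_big.
  (* Divisibility in C[x][z] is meant up to a nonzero factor c in C[x], as over C(x); Gauss's lemma
     absorbs c without changing degrees in z. *)
  have /Pdiv.Idomain.dvdpP[[c q] /= c0 /(gauss_poly_closed c0)] :=
    dvdp_gcdl (dehom h) (dehom g).
  move=> [q' [s' [e1 e2 e3]]].
  have s_le : (size s' <= d.+1)%N by rewrite e3 -szg dvdp_leq // dvdp_gcdr.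
  (* The factor s' has degree between 1 and d in z. So q' has degree 0 in z, and h would have degree
     at most d < r in z. *)
  have [q'1|] := dehom_irreducible h_irr hh e1; last first.
    by rewrite e3 leqNgt gcd_big.
  have := size_polyMleq q' s'; rewrite -e1 szh.
  by move: (size q') (size s') q'1 s_le lt_dr => m n; lia.
have res0 : resultant (dehom h) (dehom g) != 0.
  by rewrite resultant_eq0 -leqNgt.
have [a ra] := closed_nonrootP _ res0.
(* The coefficient of z^r in [ha] is that of h, a nonzero constant, so [ha] has degree r > 0
   whatever a is. *)
pose ha := map_poly (horner_eval a) (dehom h).
have [|b rb] := closed_rootP ha _.
  have : (r < size ha)%N.
    rewrite ltnNge; apply/negP => /leq_sizeP/(_ r (leqnn r)).
    rewrite coef_map (coef_dehom_top hh) /= /horner_eval hornerC => /eqP.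
    by rewrite (negbTE h_top).
  by rewrite neq_ltn; move: lt_dr; lia.
(* The resultant is a combination of h and g at y = 1. It vanishes at a, since h and then g vanish
   at (a, 1, b). *)
have [||[u w] [_ _ /(congr1 (fun p => p.[b%:P].[a]))]] :=
    resultant_in_ideal (p := dehom h) (q := dehom g).
- by rewrite szh; lia.
- by rewrite szg; lia.
have hb : meval (affine_point a b) h = 0.
  rewrite -horner_dehom; move: rb; rewrite /ha -[b](hornerC b a).
  rewrite /root horner_map /= /horner_eval => /eqP.
  by rewrite hornerC.
rewrite /= hornerC !hornerD !hornerM !horner_dehom (van _ hb) hb !mulr0 addr0.
by move/eqP; rewrite -rootE (negbTE ra).
Qed.

(** * Homogeneous parts of convergent power series *)

Section SmallPoly.
Variable K : numFieldType.
Implicit Types (p : {poly K}) (t : K).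

Lemma norm_horner_le p t : `|t| <= 1 -> `|p.[t]| <= \sum_(i < size p) `|p`_i|.
Proof.
move=> t1; rewrite horner_coef (le_trans (ler_norm_sum _ _ _)) //.
apply: ler_sum => i _; rewrite normrM normrX.
by rewrite ler_piMr // exprn_ile1.
Qed.

(** Letting t tend to 0 kills the constant term; dividing by t then lowers n by one. Over R[i] the
    condition [0 < t] means that t is real and positive. *)
Lemma poly_littleo_coef0 p (M : K) n :
  (\forall t \near (0 : K^o), 0 < t -> `|p.[t]| <= M * t ^+ n) ->
  forall j, (j < n)%N -> p`_j = 0.
Proof.
elim: n p => // n IHn p /nbhs_normP[e /= e0 small].
have smallE t : 0 < t -> t < e -> `|p.[t]| <= M * t ^+ n.+1.
  by move=> t0 te; apply: small => //=; rewrite sub0r normrN gtr0_norm.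
have M0 : 0 <= M.
  have h0 : 0 < e / 2 by rewrite divr_gt0.
  have := smallE _ h0 _; rewrite ltr_pdivrMr // ltr_pMr // ltr1n => /(_ isT).
  by move=> /(le_trans (normr_ge0 _)); rewrite pmulr_lge0 // exprn_gt0.
elim/poly_ind: p small smallE => [|q c _] _ smallE j lt_jn.
  by rewrite coef0.
have qE t : (q * 'X + c%:P).[t] = q.[t] * t + c by rewrite !hornerE.
pose N := \sum_(i < size q) `|q`_i|.
have N0 : 0 <= N by apply: sumr_ge0 => i _; exact: normr_ge0.
have c0 : c = 0.
  apply/eqP; apply: contraT; rewrite -normr_gt0 => c_gt0.
  (* The point 1/T is less than 1, than e and than |c| / (N + M). *)
  pose T := 1 + e^-1 + (N + M) / `|c|.
  have NM0 : 0 <= (N + M) / `|c| by rewrite divr_ge0 ?addr_ge0 // ltW.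
  have eV0 : 0 < e^-1 by rewrite invr_gt0.
  have T0 : 0 < T by rewrite ltr_pwDl // addr_gt0.
  have t0 : 0 < T^-1 by rewrite invr_gt0.
  have te : T^-1 < e.
    rewrite -[e]invrK ltf_pV2 ?posrE // /T -addrA addrCA ltrDl.
    by rewrite ltr_pwDl.
  have t1 : T^-1 < 1.
    rewrite -[1 in ltRHS]invr1 ltf_pV2 ?posrE // /T -addrA ltrDl.
    by rewrite ltr_pwDl.
  have := smallE _ t0 te; rewrite qE => small_t.
  have : `|c| <= (N + M) * T^-1.
    have -> : c = (q.[T^-1] * T^-1 + c) - q.[T^-1] * T^-1.
      by rewrite addrAC subrr add0r.
    rewrite (le_trans (ler_normB _ _)) // addrC mulrDl lerD //.
      rewrite normrM (gtr0_norm t0) ler_pM2r // norm_horner_le //.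
      by rewrite gtr0_norm // ltW.
    rewrite (le_trans small_t) // ler_wpM2l // exprS ler_piMr // ?(ltW t0) //.
    by rewrite exprn_ile1 ?ltW.
  rewrite ler_pdivlMr // mulrC -ler_pdivlMr //.
  have : (N + M) / `|c| < T by rewrite /T ltrDr addr_gt0.
  by move=> lt_T /(lt_le_trans lt_T); rewrite ltxx.
move: smallE; rewrite c0 addr0 => smallE.
rewrite coefMX; case: j => // j in lt_jn *.
apply: (IHn q) => //; apply/nbhs_normP; exists e => //= t.
rewrite /= sub0r normrN => te t0; rewrite gtr0_norm // in te.
have := smallE _ t0 te; rewrite hornerMX normrM (gtr0_norm t0).
by rewrite exprSr mulrA ler_pM2r.
Qed.

End SmallPoly.

(** * Tails of series graded by degree *)

Section GradedSeries.
Variables (K : numFieldType) (I : choiceType) (deg : I -> nat) (u : I -> K).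

Lemma geometric_tail_le (q : K) n m : 0 <= q -> q * 2 <= 1 ->
  \sum_(n <= k < m) q ^+ k <= 2 * q ^+ n.
Proof.
move=> q0 q2; have [le_nm|lt_mn] := leqP n m; last first.
  by rewrite big_geq ?(ltnW lt_mn) // mulr_ge0 // exprn_ge0.
(* The extra term [2 * q ^+ m], a bound for the rest of the series, makes the induction on m go
   through. *)
suff : \sum_(n <= k < m) q ^+ k + 2 * q ^+ m <= 2 * q ^+ n.
  by apply: le_trans; rewrite lerDl mulr_ge0 // exprn_ge0.
elim: m le_nm => [|m IHm].
  by rewrite leqn0 => /eqP->; rewrite big_geq // add0r.
rewrite leq_eqVlt => /predU1P[->|lt_nm]; first by rewrite big_geq // add0r.
apply: (le_trans _ (IHm lt_nm)).
rewrite big_nat_recr //= -addrA lerD2l.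
have -> : 2 * q ^+ m = q ^+ m + q ^+ m by rewrite mulr_natl mulr2n.
by rewrite lerD2l exprS mulrCA mulrA ler_piMl ?exprn_ge0.
Qed.

Lemma sum_by_degree (f : I -> K) (r : seq I) n m :
  \sum_(i <- r | (n <= deg i < m)%N) f i =
    \sum_(n <= k < m) \sum_(i <- r | deg i == k) f i.
Proof.
under [RHS]eq_bigr do rewrite big_mkcond.
rewrite exchange_big /= big_mkcond; apply: eq_bigr => i _.
under eq_bigr do rewrite eq_sym.
by rewrite -big_mkcond /= big_nat1_eq.
Qed.

(** The part of degree k at t is (t / s)^k times the one at s, and the latter, itself a finite
    partial sum, is at most B in norm. What remains is a geometric series of ratio at most 1/2. *)
Lemma graded_tail_le (s t B : K) n (J : {fset I}) : 0 < s -> 0 <= t ->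
  t * 2 <= s ->
  (forall J' : {fset I}, `|\sum_(i <- J') s ^+ deg i * u i| <= B) ->
  `|\sum_(i <- J | (n <= deg i)%N) t ^+ deg i * u i| <= 2 * B * (t / s) ^+ n.
Proof.
move=> s0 t0 t2 bnd; pose m := (\max_(i <- J) deg i).+1.
have -> : \sum_(i <- J | (n <= deg i)%N) t ^+ deg i * u i =
    \sum_(n <= k < m)
      (t / s) ^+ k * \sum_(i <- J | deg i == k) s ^+ deg i * u i.
  rewrite big_seq_cond (eq_bigl (fun i => (i \in J) && (n <= deg i < m)%N)).
    rewrite -big_seq_cond sum_by_degree; apply: eq_bigr => k _.
    rewrite mulr_sumr; apply: eq_bigr => i /eqP ->.
    by rewrite mulrA -exprMn divfK // gt_eqF.
  move=> i /=; case iJ: (i \in J) => //=.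
  by rewrite ltnS leq_bigmax_seq ?andbT.
have B0 : 0 <= B by apply: le_trans (bnd fset0); exact: normr_ge0.
have q0 : 0 <= t / s by rewrite divr_ge0 // ltW.
rewrite (le_trans (ler_norm_sum _ _ _)) //.
apply: (@le_trans _ _ (\sum_(n <= k < m) (t / s) ^+ k * B)).
  apply: ler_sum => k _; rewrite normrM ger0_norm ?exprn_ge0 //.
  rewrite ler_wpM2l ?exprn_ge0 //.
  by rewrite big_fset_condE bnd.
rewrite -mulr_suml mulrAC ler_wpM2r // geometric_tail_le //.
by rewrite mulrAC ler_pdivrMr // mul1r.
Qed.

End GradedSeries.

Lemma partial_sumE (I : choiceType) (V : zmodType) (x : I -> V) (J : {fset I}) :
  partial_sum x J = \sum_(i <- J) x i.
Proof. by rewrite big_seq_fsetE. Qed.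

(** * Taylor expansion along lines through 0 *)

Section PowerSeries.
Variables (R : realType) (n : nat).
Local Notation C := R[i].
Local Notation pt := 'rV[C^o]_n.
Implicit Types (a : multinom n -> C) (v w : pt) (t : C).

(** [bmultinom n k.+1] is the finite type of exponents of degree less than k + 1; it gives the sum
    over degree k a finite range. *)
Definition homog_part a (k : nat) : {mpoly C[n]} :=
  \sum_(m : bmultinom n k.+1 | mdeg m == k) a m *: mpolyX C m.

Lemma homog_part_homog a k : homog_part a k \is ishomog1 k mdeg.
Proof.
by apply: rpred_sum => m mk; rewrite rpredZ // dhomogX.
Qed.

Lemma mmap1_scale t v (m : multinom n) :
  mmap1 ((t *: v) ord0) m = t ^+ mdeg m * mmap1 (v ord0) m.
Proof.
rewrite /mmap1 mdegE -prodrXr -big_split /=; apply: eq_bigr => i _.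
by rewrite mxE exprMn.
Qed.

Lemma poly_fun_homog d (p : {mpoly C[n]}) t v : p \is ishomog1 d mdeg ->
  poly_fun p (t *: v) = t ^+ d * poly_fun p v.
Proof.
move=> /dhomogP hp; rewrite /poly_fun !mevalE mulr_sumr.
apply: eq_big_seq => m mp.
have md : mdeg m = d := hp m mp.
have := mmap1_scale t v m; rewrite /mmap1 md => ->.
by rewrite mulrCA.
Qed.

Lemma near_line (P : pt -> Prop) v : (\forall w \near (0 : pt), P w) ->
  \forall t \near (0 : C^o), P (t *: v).
Proof.
move=> nP; have /(_ P) := @scalel_continuous C pt v (0 : C^o).
by rewrite /= scale0r; apply.
Qed.

Lemma poly_fun_homog_part a k v :
  poly_fun (homog_part a k) v =
    \sum_(m : bmultinom n k.+1 | mdeg m == k) a m * mmap1 (v ord0) m.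
Proof.
rewrite /poly_fun /homog_part raddf_sum; apply: eq_bigr => m _ /=.
by rewrite mevalZ mevalX.
Qed.

Lemma sum_multinom_degree (f : multinom n -> C) k (J : {fset multinom n}) :
  (forall m, mdeg m = k -> m \in J) ->
  \sum_(m : bmultinom n k.+1 | mdeg m == k) f m =
    \sum_(m <- J | mdeg m == k) f m.
Proof.
move=> kJ; rewrite -(big_map (@bmnm n k.+1) (fun m => mdeg m == k) f).
rewrite -[LHS]big_filter -[RHS]big_filter; apply: perm_big.
apply: uniq_perm; rewrite ?filter_uniq ?fset_uniq //.
  by rewrite map_inj_uniq ?index_enum_uniq //; exact: val_inj.
move=> m; rewrite !mem_filter; case: eqP => //= mk.
rewrite kJ //; apply/mapP.
have lt_mk : (mdeg m < k.+1)%N by rewrite mk.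
by exists (BMultinom lt_mk); rewrite ?mem_index_enum.
Qed.

(** A finite partial sum close to F (t v) splits by degree: degrees below N give the Taylor
    polynomial, and the rest is a tail controlled by the bounded partial sums at a fixed point s v
    with 2 t <= s. *)
Lemma power_series_taylor a (F : pt -> C) v (N : nat) :
  (\forall w \near (0 : pt), power_series_sum a w (F w)) ->
  exists M : C, \forall t \near (0 : C^o), 0 < t ->
    `|F (t *: v) - \sum_(k < N) poly_fun (homog_part a k) v * t ^+ k| <= M * t ^+ N.
Proof.
move=> /(near_line v)/nbhs_normP[e /= e0 conv].
pose u m := a m * mmap1 (v ord0) m.
pose S t (J : {fset multinom n}) := \sum_(m <- J) t ^+ mdeg m * u m.
have convE t (eps : C) : 0 < eps -> `|t| < e ->
    exists J0 : {fset multinom n}, forall J, (J0 `<=` J)%fset ->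
      `|F (t *: v) - S t J| < eps.
  move=> eps0 te; have /conv : ball_ (fun x : C^o => `|x|) 0 e t.
    by rewrite /= sub0r normrN.
  move=> /(_ _ (nbhsx_ballx (F (t *: v) : C^o) eps eps0)) [J0 _ J0P].
  exists J0 => J /J0P; rewrite /ball /=; congr (`|_ - _| < _).
  rewrite partial_sumE; apply: eq_bigr => m _.
  by rewrite mmap1_scale mulrCA.
pose s := e / 2.
have s0 : 0 < s by rewrite divr_gt0.
have [J0 J0P] : exists J0 : {fset multinom n}, forall J, (J0 `<=` J)%fset ->
    `|F (s *: v) - S s J| < 1.
  by apply: convE => //; rewrite gtr0_norm // ltr_pdivrMr // ltr_pMr // ltr1n.
(* All finite partial sums at s v are bounded by B: up to the terms indexed by
   J0, they differ from a partial sum within 1 of F (s v). *)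
pose B := `|F (s *: v)| + 1 + \sum_(m <- J0) `|s ^+ mdeg m * u m|.
have bnd (J : {fset multinom n}) : `|S s J| <= B.
  have SU : S s (J0 `|` J)%fset =
      S s J + \sum_(m <- J0 | m \notin J) s ^+ mdeg m * u m.
    rewrite /S (big_fsetID _ (mem J)) /= [X in _ = _ + X]big_fset_condE.
    congr (_ + _).
      apply: eq_fbigl => m; rewrite !inE /= andb_orl andbb.
      by case: (m \in J); rewrite ?orbT ?andbF.
    apply: eq_fbigl => m; rewrite !inE /=.
    by case: (m \in J); rewrite ?orbT ?orbF ?andbF.
  have -> : S s J = F (s *: v) - (F (s *: v) - S s (J0 `|` J)%fset)
      - \sum_(m <- J0 | m \notin J) s ^+ mdeg m * u m.
    by rewrite subKr SU addrK.
  rewrite (le_trans (ler_normB _ _)) // lerD //.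
    rewrite (le_trans (ler_normB _ _)) // lerD2l ltW // J0P //.
    exact: fsubsetUl.
  rewrite (le_trans (ler_norm_sum _ _ _)) // big_mkcond /=.
  by apply: ler_sum => m _; case: ifP.
(* The first term bounds the tail; the 1 pays for approximating F (t v) to within t^N. The radius s
   / 2 keeps t / s below 1/2. *)
exists (2 * B / s ^+ N + 1); apply/nbhs_normP; exists (s / 2) => /=.
  by rewrite divr_gt0.
move=> t; rewrite /= sub0r normrN => ts t0; rewrite (gtr0_norm t0) in ts.
have t2s : t * 2 <= s by rewrite -ler_pdivlMr // ltW.
have te : `|t| < e.
  rewrite gtr0_norm // (lt_trans ts) // /s -mulrA -invfM ltr_pdivrMr //.
  by rewrite ltr_pMr // -natrM ltr1n.
have [J1 J1P] := convE t (t ^+ N) (exprn_gt0 _ t0) te.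
pose D := seq_fset tt [seq bmnm m | m <- index_enum (bmultinom n N)].
have DP m : (mdeg m < N)%N -> m \in D.
  move=> mN; rewrite seq_fsetE; apply/mapP.
  by exists (BMultinom mN); rewrite ?mem_index_enum.
(* [J1] gives the accuracy t^N, and [D] contains every exponent of degree below N, so that the low
   part of the sum over [J] is complete. *)
pose J := (J1 `|` D)%fset.
have lowE : \sum_(m <- J | ~~ (N <= mdeg m)%N) t ^+ mdeg m * u m =
    \sum_(k < N) poly_fun (homog_part a k) v * t ^+ k.
  rewrite (eq_bigl (fun m => (0 <= mdeg m < N)%N)); last first.
    by move=> m; rewrite leq0n -ltnNge.
  rewrite sum_by_degree big_mkord; apply: eq_bigr => k _.
  rewrite poly_fun_homog_part (@sum_multinom_degree u k J); last first.
    by move=> m mk; rewrite !inE DP ?orbT // mk.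
  by rewrite mulr_suml; apply: eq_bigr => m /eqP->; rewrite mulrC.
have SE : S t J = \sum_(m <- J | (N <= mdeg m)%N) t ^+ mdeg m * u m +
    \sum_(k < N) poly_fun (homog_part a k) v * t ^+ k.
  by rewrite /S (bigID (fun m => (N <= mdeg m)%N)) /= lowE.
set T := \sum_(k < N) _ in SE *.
have -> : F (t *: v) - T = F (t *: v) - S t J + (S t J - T).
  by rewrite addrA subrK.
rewrite SE addrK (le_trans (ler_normD _ _)) // addrC mulrDl mul1r lerD //.
  rewrite (le_trans (graded_tail_le _ _ s0 (ltW t0) t2s bnd)) //.
  by rewrite exprMn exprVn mulrA mulrAC.
by rewrite -SE ltW // J1P // fsubsetUl.
Qed.

End PowerSeries.

(** * From membership of germs to an identity between forms *)

Section GermIdeal.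
Variables (R : realType) (n : nat).
Local Notation C := R[i].
Local Notation pt := 'rV[C^o]_n.

(** If v is in the cone, so is the line of all t v. The terms in t^d of the germ equation on it
    involve only the parts of degree d - d1 and d - d2 of the two power series, and these parts do
    not depend on v. *)
Lemma germ_ideal_homog (h f1 f2 f : {mpoly C[n]}) r d1 d2 d :
  h \is ishomog1 r mdeg -> f1 \is ishomog1 d1 mdeg -> f2 \is ishomog1 d2 mdeg ->
  f \is ishomog1 d mdeg -> (d1 <= d)%N -> (d2 <= d)%N ->
  in_germ_ideal2 (zero_locus h) 0 (poly_fun f1) (poly_fun f2) (poly_fun f) ->
  exists g1 g2 : {mpoly C[n]},
    [/\ g1 \is ishomog1 (d - d1) mdeg, g2 \is ishomog1 (d - d2) mdeg &
        forall v : pt, poly_fun h v = 0 ->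
          poly_fun f v = poly_fun (g1 * f1 + g2 * f2) v].
Proof.
move=> hh hf1 hf2 hf le1 le2 [b1 [b2 [[F1 [a1 s1] e1] [F2 [a2 s2] e2] e]]].
exists (homog_part a1 (d - d1)), (homog_part a2 (d - d2)); split; try exact: homog_part_homog.
move=> v hv.
have Xv t : zero_locus h (t *: v).
  by rewrite /zero_locus /= (poly_fun_homog _ _ hh) hv mulr0.
have N1 := near_line v e1; have N2 := near_line v e2; have N := near_line v e.
have sub0 (a : multinom n -> C) F :
    (\forall w \near (0 : pt), power_series_sum a (w - 0) (F w)) ->
    \forall w \near (0 : pt), power_series_sum a w (F w).
  by apply: filterS => w; rewrite subr0.
(* Order d + 1 makes the error negligible against the term t^d to be compared. *)
have [M1 T1] := power_series_taylor v d.+1 (sub0 _ _ s1).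
have [M2 T2] := power_series_taylor v d.+1 (sub0 _ _ s2).
pose tp a := \poly_(k < d.+1) poly_fun (homog_part a k) v : {poly C}.
pose c1 := poly_fun f1 v; pose c2 := poly_fun f2 v.
pose p := poly_fun f v *: 'X^d - c1 *: (tp a1 * 'X^d1) - c2 *: (tp a2 * 'X^d2).
have : p`_d = 0.
  apply: (@poly_littleo_coef0 _ p (M1 * `|c1| + M2 * `|c2|) d.+1) => //.
  near=> t => t0.
  have t1 : `|t| <= 1 by near: t; apply/nbhs_normP; exists 1 => //= x;
    rewrite /= sub0r normrN => /ltW.
  have E1 : b1 (t *: v) = F1 (t *: v) by move: (Xv t); near: t; exact: N1.
  have E2 : b2 (t *: v) = F2 (t *: v) by move: (Xv t); near: t; exact: N2.
  have E : poly_fun f (t *: v) = b1 (t *: v) * poly_fun f1 (t *: v)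
      + b2 (t *: v) * poly_fun f2 (t *: v).
    by move: (Xv t); near: t; exact: N.
  have T1t : `|F1 (t *: v) - (tp a1).[t]| <= M1 * t ^+ d.+1.
    by rewrite horner_poly; move: t0; near: t; exact: T1.
  have T2t : `|F2 (t *: v) - (tp a2).[t]| <= M2 * t ^+ d.+1.
    by rewrite horner_poly; move: t0; near: t; exact: T2.
  move: E; rewrite E1 E2 (poly_fun_homog _ _ hf) (poly_fun_homog _ _ hf1).
  rewrite (poly_fun_homog _ _ hf2) -/c1 -/c2 => E.
  (* Subtracting the germ equation leaves only the Taylor errors, multiplied by c1 t^d1 and c2
     t^d2. *)
  have -> : p.[t] = (F1 (t *: v) - (tp a1).[t]) * c1 * t ^+ d1
      + (F2 (t *: v) - (tp a2).[t]) * c2 * t ^+ d2.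
    have -> : p.[t] = t ^+ d * poly_fun f v - c1 * ((tp a1).[t] * t ^+ d1)
        - c2 * ((tp a2).[t] * t ^+ d2).
      rewrite /p !(hornerD, hornerN, hornerZ, hornerM, hornerXn).
      by rewrite (mulrC (poly_fun f v)).
    by rewrite E; ring.
  have bound (x M c : C) k : `|x| <= M * t ^+ d.+1 ->
      `|x * c * t ^+ k| <= M * `|c| * t ^+ d.+1.
    move=> xM; rewrite !normrM normrX mulrAC [leRHS]mulrAC ler_wpM2r //.
    by rewrite (le_trans _ xM) // ler_piMr // exprn_ile1.
  by rewrite (le_trans (ler_normD _ _)) // [leRHS]mulrDl lerD // bound.
(* As d1, d2 <= d, the factors X^d1 and X^d2 shift the coefficients d - d1 and d - d2 into degree
   d. *)
rewrite /p !coefB !coefZ coefXn eqxx mulr1 !coefMXn !ltnNge le1 le2 /=.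
rewrite !coef_poly !ltnS !leq_subr => /eqP.
rewrite -addrA -opprD subr_eq0 => /eqP->.
by rewrite /poly_fun mevalD !mevalM (mulrC c1) (mulrC c2).
Unshelve. all: by end_near. Qed.

End GermIdeal.

(** * The powers of x, y, z on the cone *)

Theorem corollary8 (R : realType) (h : {mpoly R[i][3]}) (r d0 d1 d2 : nat) :
  let x : {mpoly R[i][3]} := mpolyX R[i] (mnm1 (0 : 'I_3)) in
  let y : {mpoly R[i][3]} := mpolyX R[i] (mnm1 (1 : 'I_3)) in
  let z : {mpoly R[i][3]} := mpolyX R[i] (mnm1 (2 : 'I_3)) in
  irreducible_elt h ->
  h \is ishomog1 r mdeg ->
  mcoeff (mnm_muln (mnm1 (2 : 'I_3)) r) h != 0 ->
  let X : set 'rV[R[i]^o]_3 := zero_locus h in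
  normal_analytic_set X ->
  (1 <= d1)%N -> (1 <= d2)%N -> (d1 + d2 < d0)%N -> (d0 < r)%N ->
  let f1 := x ^+ d1 in
  let f2 := y ^+ d2 in
  let f0 := z ^+ d0 in
  [/\ [/\ f1 \is ishomog1 d1 mdeg, f2 \is ishomog1 d2 mdeg
        & f0 \is ishomog1 d0 mdeg],
      X `&` (zero_locus f1 `&` zero_locus f2) = [set 0],
      ~ in_germ_ideal2 X 0 (poly_fun f1) (poly_fun f2) (poly_fun f0)
    & d1%:Z + d2%:Z - d0%:Z < 0].
Proof.
move=> x y z h_irr hh h_top X _ d1_gt0 d2_gt0 lt_d lt_dr f1 f2 f0.
have homX (i : 'I_3) d : mpolyX R[i] (mnm1 i) ^+ d \is ishomog1 d mdeg.
  have := dhomogMn d (_ : mpolyX R[i] (mnm1 i) \is ishomog1 1 mdeg).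
  by rewrite mul1n; apply; rewrite dhomogX; apply/eqP/mdeg1.
have evX (i : 'I_3) d v : meval v (mpolyX R[i] (mnm1 i) ^+ d) = v i ^+ d.
  by rewrite rmorphXn /= mevalXU.
have r_gt0 : (0 < r)%N by lia.
split; last by lia.
- by split; exact: homX.
- apply/seteqP; split=> [v [hv [v0 v1]]|v ->]; last first.
    have at0 d (p : {mpoly R[i][3]}) : (0 < d)%N -> p \is ishomog1 d mdeg ->
        zero_locus p (0 : 'rV[R[i]^o]_3).
      move=> d_gt0 hp; rewrite /zero_locus /= -(scale0r 0).
      by rewrite (poly_fun_homog _ _ hp) expr0n gtn_eqF // mul0r.
    split; first exact: at0 hh.
    by split; [exact: at0 (homX 0 d1)|exact: at0 (homX 1 d2)].
  have {}v0 : v ord0 0 = 0.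
    by apply/eqP; move/eqP: v0; rewrite /poly_fun evX expf_eq0 => /andP[].
  have {}v1 : v ord0 1 = 0.
    by apply/eqP; move/eqP: v1; rewrite /poly_fun evX expf_eq0 => /andP[].
  (* With x = y = 0, h reduces to c z^r with c nonzero. *)
  have v2 : v ord0 2 = 0.
    apply/eqP; move/eqP: hv; rewrite /poly_fun (meval_axis hh v0 v1).
    by rewrite mulf_eq0 (negbTE h_top) expf_eq0 => /andP[].
  apply/rowP => -[[|[|[|?]]] lt3] //; rewrite [RHS]mxE.
  + by rewrite -[RHS]v0; congr (v _ _); apply/val_inj.
  + by rewrite -[RHS]v1; congr (v _ _); apply/val_inj.
  + by rewrite -[RHS]v2; congr (v _ _); apply/val_inj.
move=> /(germ_ideal_homog hh (homX _ _) (homX _ _) (homX _ _)).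
have [le1 le2] : (d1 <= d0)%N /\ (d2 <= d0)%N by lia.
move=> /(_ le1 le2)[g1 [g2 [hg1 hg2 g_eq]]].
(* A form of degree d0 that vanishes on X, which would force r <= d0. *)
pose g := f0 - (g1 * f1 + g2 * f2).
have hg : g \is ishomog1 d0 mdeg.
  rewrite rpredB ?homX // rpredD //.
    by rewrite -(subnK le1) dhomogM ?homX.
  by rewrite -(subnK le2) dhomogM ?homX.
suff : (r <= d0)%N by rewrite leqNgt lt_dr.
apply: (vanishing_form_degree h_irr hh h_top _ hg); first by lia.
(* At (0, 0, 1) the terms in x^d1 and y^d2 vanish, as d1 and d2 are positive, so the coefficient of
   z^d0 in [g] is 1. *)
- pose e (i : 'I_3) : R[i] := (i == 2)%:R.
  have := meval_axis hg (erefl : e 0 = 0) (erefl : e 1 = 0).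
  rewrite expr1n mulr1 => <-.
  rewrite mevalB mevalD !mevalM !evX /e /= expr1n !expr0n !gtn_eqF //.
  by rewrite !mulr0 addr0 subr0 oner_eq0.
- move=> v hv; have := g_eq (\row_i v i).
  have ev p : poly_fun p (\row_i v i) = meval v p.
    by apply: meval_eq => i; rewrite mxE.
  by rewrite !ev => /(_ hv) E; rewrite /g mevalB E subrr.
Qed.
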